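(* Let $G$ be a connected weighted graph of order $n\ge 2$. Then $$K(G)\ \ge\ n-2+\frac{1}{\chi(G)}.$$ If $G$ is unweighted, equality holds if and only if one of the following holds: (i) $\chi(G)=2$ and $G$ is complete bipartite; (ii) $\chi(G)=r\ge 3$, $r$ divides $n$, and $G\cong T_r(n)$, the balanced complete $r$-partite graph on $n$ vertices.
   Context: Graphs are finite, simple, connected, undirected and weighted: $G=(V,E,c)$ with symmetric weights $c(i,j)=c_{ij}=c_{ji}>0$ if $\{i,j\}\in E$ and $c_{ij}=0$ otherwise (no loops), $|V|=n$; $G$ is unweighted if all edge weights equal $1$. $\chi(G)$ is the chromatic number of the underlying graph $(V,E)$. The degree of vertex $i$ is $k_i=\sum_j c_{ij}$, $D=\operatorname{diag}(k_1,\dots,k_n)$, $A=(c_{ij})$ is the adjacency matrix. The normalized adjacency matrix is $M_G=D^{-1/2}AD^{-1/2}$, with eigenvalues $1=\lambda_1>\lambda_2\ge\cdots\ge\lambda_n\ge-1$. Kemeny's constant is $K(G)=\sum_i\pi_i m_{ji}-1$ for the random walk with transition matrix $D^{-1}A$, where $\pi$ is the stationary distribution and $m_{ji}$ the mean first passage time from $j$ to $i$ (with $m_{jj}$ the mean first return time); this does not depend on $j$, and it is known that $K(G)=\sum_{j=2}^{n}\frac{1}{1-\lambda_j}$. For $r\mid n$, $T_r(n)$ is the complete $r$-partite graph with all parts of size $n/r$. *)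

(* Defs.v *)
From HB Require Import structures.
From mathcomp Require Import all_boot all_order all_algebra.
From mathcomp Require Import all_classical all_reals all_analysis.

Set Implicit Arguments.
Unset Strict Implicit.
Unset Printing Implicit Defensive.

Import Order.TTheory GRing.Theory Num.Theory.
Local Open Scope ring_scope.

Record wgraph (R : realType) (n : nat) := WGraph {
  edge : rel 'I_n;
  weight : 'M[R]_n;
  edge_sym : symmetric edge;
  edge_irrefl : irreflexive edge;
  weight_sym : forall i j, weight i j = weight j i;
  weight_gt0 : forall i j, edge i j -> 0 < weight i j;
  weight_eq0 : forall i j, ~~ edge i j -> weight i j = 0 }.

Section Graph.
Variables (R : realType) (n : nat) (G : wgraph R n).

Definition connected_graph := forall i j, connect (edge G) i j.

Definition unweighted := forall i j, edge G i j -> weight G i j = 1.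

Definition colorable (k : nat) :=
  [exists f : {ffun 'I_n -> 'I_k},
    [forall i, forall j, edge G i j ==> (f i != f j)]].

Lemma ex_colorable : exists k, colorable k.
Proof.
exists n; apply/existsP; exists [ffun i => i].
apply/forallP => i; apply/forallP => j; apply/implyP => eij; rewrite !ffunE.
by apply: contraTneq eij => ->; rewrite edge_irrefl.
Qed.

Definition chromatic_number : nat := ex_minn ex_colorable.

Definition degree (i : 'I_n) : R := \sum_j weight G i j.

Definition degree_mx : 'M[R]_n := diag_mx (\row_i degree i).

Definition transition_mx : 'M[R]_n := invmx degree_mx *m weight G.

End Graph.

Section MarkovChain.
Variables (R : realType) (n : nat) (P : 'M[R]_n).

Definition is_stationary (pi : 'rV[R]_n) :=
  [/\ forall i, 0 <= pi 0 i, \sum_i pi 0 i = 1 & pi *m P = pi].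

(* Unique for an irreducible chain; [0] if no stationary distribution exists. *)
Definition stationary_distribution : 'rV[R]_n :=
  xget 0 [set pi | is_stationary pi]%classic.

(* Probability that the chain started at [x] follows the trajectory [s]. *)
Fixpoint trajectory_prob (x : 'I_n) (s : seq 'I_n) : R :=
  if s is y :: s' then P x y * trajectory_prob y s' else 1.

(* [first_passage_prob j i t] is the probability, starting at [j], that the
   first visit to [i] at a positive time happens at time [t.+1]: the tuple [w]
   lists the states at times 1, ..., t.+1, and [index i w == t] says that its
   last entry is [i] and that no earlier one is. *)
Definition first_passage_prob (j i : 'I_n) (t : nat) : R :=
  \sum_(w : t.+1.-tuple 'I_n | index i w == t) trajectory_prob j w.

(* For [i = j] this is the mean first return time. *)
Definition mean_first_passage (j i : 'I_n) : \bar R :=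
  (\sum_(0 <= t <oo) (t.+1%:R * first_passage_prob j i t)%:E)%E.

End MarkovChain.

(* The value does not depend on [j] when [G] is connected. *)
Definition kemeny (R : realType) (n : nat) (G : wgraph R n) (j : 'I_n) : \bar R :=
  let P := transition_mx G in
  (\sum_i (stationary_distribution P 0 i)%:E * mean_first_passage P j i - 1)%E.

Definition complete_bipartite (T : finType) (e : rel T) :=
  exists A : {set T}, [/\ A != finset.set0, ~: A != finset.set0 &
    forall x y, e x y = (x \in A) (+) (y \in A)].

(* The complete r-partite graph whose parts are [{a} x 'I_(n %/ r)]. *)
Definition balanced_multipartite (r n : nat) : rel ('I_r * 'I_(n %/ r)) :=
  fun x y => x.1 != y.1.

Definition graph_iso (T U : finType) (e : rel T) (f : rel U) :=
  exists2 h : T -> U, bijective h & forall x y, e x y = f (h x) (h y).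

(* Main.v *)
(* With [k] the degrees, [V] their sum and [t > 0], put
   [B = D - A + (t/V) k k^T], which is positive definite, and [Z = B^-1].
   Writing [Z] in terms of the mean first passage times gives
   [\tr (D Z) = K(G) + 1/t].  For a proper colouring, [A] vanishes on the
   diagonal blocks of [B], so these are rank-one perturbations of diagonal
   matrices with explicit inverses, assembled into [Y].  Pinching gives
   [Z_ii >= Y_ii], with equality for all [i] iff [B] is block diagonal, that is
   [c_ij = t k_i k_j / V] whenever [i] and [j] have different colours.  For
   [t = r/(r-1)] with [r] colours, concavity gives [\tr (D Y) >= n - 1], with
   equality iff every colour class has volume [V/r]. *)
Require Import Defs.
From HB Require Import structures.
From mathcomp Require Import all_boot all_order all_algebra.
From mathcomp Require Import all_classical all_reals all_analysis.
From mathcomp Require Import ring lra.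

Set Implicit Arguments.
Unset Strict Implicit.
Unset Printing Implicit Defensive.

Import Order.TTheory GRing.Theory Num.Theory.
Import numFieldNormedType.Exports.
Local Open Scope ring_scope.

(** * First-passage probabilities and the taboo operator *)

Section FirstPassage.
Variables (R : realType) (n : nat) (P : 'M[R]_n) (i : 'I_n).

(* The transition operator of the chain killed on entering [i]. *)
Definition taboo (x : 'I_n -> R) (j : 'I_n) : R :=
  \sum_(k | k != i) P j k * x k.

Lemma first_passage_prob0 j : first_passage_prob P j i 0 = P j i.
Proof.
rewrite /first_passage_prob (reindex (fun k : 'I_n => [tuple k])) /=; last first.
  exists (@thead 0 _) => [k _ //|w _].
  by apply: val_inj; case/tupleP: w => k w /=; rewrite (tuple0 w).
rewrite (big_pred1 i) => [|k /=]; first by rewrite mulr1.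
by case: (k == i).
Qed.

Lemma first_passage_probS j t :
  first_passage_prob P j i t.+1 =
  taboo (fun k => first_passage_prob P k i t) j.
Proof.
rewrite /first_passage_prob /taboo.
rewrite (reindex (fun p : 'I_n * t.+1.-tuple 'I_n => [tuple of p.1 :: p.2]))
  /=; last first.
  exists (fun w => (thead w, [tuple of behead w])) => [[k w] _|w _] /=.
    by congr pair; apply: val_inj.
  by rewrite -tuple_eta.
under [RHS]eq_bigr do rewrite mulr_sumr.
rewrite pair_big_dep /=; apply: eq_big => [[k w] /=|//].
by case: (k == i).
Qed.

End FirstPassage.

(** * Mean first passage times from the first-step equations *)

Section MeanFirstPassage.
Variables (R : realType) (n : nat) (P : 'M[R]_n) (i : 'I_n).
Hypotheses (P_ge0 : forall j k, 0 <= P j k)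
           (P_sum1 : forall j, \sum_k P j k = 1).
Local Notation Q := (taboo P i).

Lemma taboo_ext x y : x =1 y -> Q x =1 Q y.
Proof. by move=> xy j; apply: eq_bigr => k _; rewrite xy. Qed.

Lemma taboo_le x y : (forall j, x j <= y j) -> forall j, Q x j <= Q y j.
Proof. by move=> xy j; apply: ler_sum => k _; rewrite ler_wpM2l. Qed.

Lemma tabooB x y j : Q (fun k => x k - y k) j = Q x j - Q y j.
Proof. by rewrite /taboo -sumrB; apply: eq_bigr => k _; rewrite mulrBr. Qed.

Lemma tabooZ a x j : Q (fun k => a * x k) j = a * Q x j.
Proof.
by rewrite /taboo mulr_sumr; apply: eq_bigr => k _; rewrite mulrCA.
Qed.

Lemma iter_taboo_le x y t :
  (forall j, x j <= y j) -> forall j, iter t Q x j <= iter t Q y j.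
Proof. by move=> xy; elim: t => //= t IH; apply: taboo_le. Qed.

Lemma iter_taboo_ge0 x t :
  (forall j, 0 <= x j) -> forall j, 0 <= iter t Q x j.
Proof.
move=> x0; elim: t => //= t IH j.
by apply: sumr_ge0 => k _; rewrite mulr_ge0.
Qed.

(** [iter t Q (fun=> 1) j] is the probability of avoiding [i] at times 1 to [t], so a first visit at
    time [t.+1] is a drop between consecutive survival probabilities. *)
Lemma first_passage_prob_tail j t :
  first_passage_prob P j i t = iter t Q (fun=> 1) j - iter t.+1 Q (fun=> 1) j.
Proof.
elim: t j => [|t IH] j.
  rewrite first_passage_prob0 /= /taboo -[X in X - _](P_sum1 j) (bigD1 i) //=.
  by under [X in _ - X]eq_bigr do rewrite mulr1; rewrite addrK.
by rewrite first_passage_probS (taboo_ext IH) tabooB.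
Qed.

Section Solution.
Variables (h : 'I_n -> R) (h_ge0 : forall j, 0 <= h j)
          (hE : forall j, h j = 1 + Q h j).

(** Abel summation of the survival probabilities. Iterating [h - Q h = 1] makes their sum telescope,
    and the last two terms are the remainder to be shown negligible. *)
Lemma partial_mean_first_passage j T :
  \sum_(0 <= t < T) t.+1%:R * first_passage_prob P j i t =
  h j - iter T Q h j - T%:R * iter T Q (fun=> 1) j.
Proof.
have step t k : iter t Q h k = iter t Q (fun=> 1) k + iter t.+1 Q h k.
  elim: t k => [|t IH] k /=; first exact: hE.
  rewrite -[RHS]addr0 -[X in _ + X](subrr (Q (iter t Q h) k)).
  have <- : Q (fun l => iter t Q h l - iter t.+1 Q h l) k = Q (iter t Q (fun=> 1)) k.
    by apply: taboo_ext => l; rewrite IH addrK.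
  rewrite tabooB /=; ring.
elim: T => [|T IH]; first by rewrite big_geq //= mul0r subr0 subrr.
rewrite big_nat_recr //= IH first_passage_prob_tail step /= -natr1; ring.
Qed.

(* [h >= 1] turns [Q h = h - 1] into the contraction [Q h <= (1 - 1/C) h] for
   any upper bound [C] of [h]. *)
Lemma iter_taboo_geometric :
  exists2 rho, 0 <= rho < 1 & forall j t, iter t Q h j <= rho ^+ t * h j.
Proof.
have h_ge1 j : 1 <= h j.
  by rewrite hE lerDl; apply: (iter_taboo_ge0 1).
pose C := 1 + \sum_j h j.
have hC j : h j <= C.
  rewrite /C (bigD1 j) //= addrCA lerDl addr_ge0 ?sumr_ge0 //.
have C_ge1 : 1 <= C by rewrite lerDl sumr_ge0.
have C_gt0 : 0 < C by apply: lt_le_trans C_ge1.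
exists (1 - C^-1).
  by rewrite subr_ge0 invf_le1 // C_ge1 gtrBl invr_gt0.
move=> j t; elim: t j => [|t IH] j /=; first by rewrite expr0 mul1r.
apply: le_trans (taboo_le IH j) _; rewrite tabooZ exprSr -mulrA.
rewrite ler_wpM2l ?exprn_ge0 ?subr_ge0 ?invf_le1 //.
rewrite mulrBl mul1r {1}[h j]hE [1 + _]addrC -addrA lerDl subr_ge0.
by rewrite mulrC ler_pdivrMr // mul1r.
Qed.

Lemma mean_first_passageE j : mean_first_passage P j i = (h j)%:E.
Proof.
have [rho /andP[rho0 rho1] rhoP] := iter_taboo_geometric.
have h_ge1 k : 1 <= h k by rewrite hE lerDl; apply: (iter_taboo_ge0 1).
(* Writing [rho ^+ T] as [s ^+ T * s ^+ T] lets one factor absorb [T], by the bound [nsn], while the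
   other still tends to 0. *)
pose s := Num.sqrt rho.
have s0 : 0 <= s := sqrtr_ge0 rho.
have s1 : s < 1 by rewrite -sqrtr1 ltr_sqrt.
have sE : s * s = rho by rewrite -expr2 sqr_sqrtr.
have nsn T : T%:R * s ^+ T <= (1 - s)^-1.
  rewrite -[X in _ <= X]mul1r ler_pdivlMr ?subr_gt0 //.
  apply: (@le_trans _ _ (1 - s ^+ T)); last by rewrite gerBl exprn_ge0.
  have -> : 1 - s ^+ T = (1 - s) * \sum_(t < T) s ^+ t.
    by rewrite -[1 - s ^+ T]opprB subrX1 -mulNr opprB.
  rewrite mulrC ler_wpM2l ?subr_ge0 ?(ltW s1) //.
  rewrite (_ : T%:R * s ^+ T = \sum_(t < T) s ^+ T); last first.
    by rewrite sumr_const card_ord mulr_natl.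
  by apply: ler_sum => t _; apply: ler_wiXn2l; rewrite ?s0 ?(ltW s1) // ltnW.
rewrite /mean_first_passage.
have tail_cvg0 : (iter T Q h j + T%:R * iter T Q (fun=> 1) j @[T --> \oo] --> 0)%classic.
  apply: (@squeeze_cvgr _ _ _ _ (fun=> 0) (fun T => (1 + (1 - s)^-1) * h j * s ^+ T)).
  - apply: nearW => T; rewrite addr_ge0 ?mulr_ge0 ?iter_taboo_ge0 //=.
    (* Since [1 <= h], survival probabilities inherit the geometric decay of [iter T Q h]. *)
    have tail1 : iter T Q (fun=> 1) j <= rho ^+ T * h j.
      by apply: le_trans (rhoP j T); apply: iter_taboo_le.
    apply: (@le_trans _ _ (rho ^+ T * h j + T%:R * (rho ^+ T * h j))).
      by rewrite lerD ?rhoP // ler_wpM2l.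
    rewrite -sE exprMn [X in _ <= X](_ : _ =
      s ^+ T * h j + (1 - s)^-1 * (s ^+ T * h j)); last by ring.
    rewrite lerD //.
      rewrite ler_wpM2r // ler_piMl ?exprn_ge0 // exprn_ile1 // ltW //.
    rewrite -mulrA mulrA; apply: ler_wpM2r (nsn T).
    by rewrite mulr_ge0 ?exprn_ge0.
  - exact: cvg_cst.
  - rewrite -[X in (_ --> X)%classic](mulr0 ((1 + (1 - s)^-1) * h j)).
    by apply: cvgMl_tmp; apply: cvg_expr; rewrite ger0_norm.
apply: cvg_lim => //.
under eq_fun do rewrite sumEFin partial_mean_first_passage -addrA -opprD.
apply: cvg_EFin; first exact: nearW.
rewrite -[X in (_ --> X)%classic]subr0.
by apply: cvgB => //; exact: cvg_cst.
Qed.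

End Solution.
End MeanFirstPassage.

(** * Dirichlet form, stationary distribution and hitting times of the walk *)

Section Potential.
Variables (R : realType) (n : nat) (G : wgraph R n).
Hypotheses (n_ge2 : (2 <= n)%N) (Gconn : connected_graph G).
Local Notation c := (weight G).
Local Notation k := (degree G).
Local Notation P := (transition_mx G).
Local Notation V := (\sum_i degree G i).

Lemma weight_ge0 i j : 0 <= c i j.
Proof.
by have [/weight_gt0/ltW|/weight_eq0->] := boolP (edge G i j).
Qed.

Lemma exists_edge i : exists j, edge G i j.
Proof.
have [j ji] : exists j : 'I_n, j != i.
  case: i => [[|i] ilt].
    by exists (Ordinal n_ge2).
  by exists (Ordinal (ltnW n_ge2)).
have /connectP[[|l p] /=] := Gconn i j; first by move=> _ E; rewrite E eqxx in ji.
by case/andP => eil _ _; exists l.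
Qed.

Lemma degree_gt0 i : 0 < k i.
Proof.
have [j eij] := exists_edge i.
rewrite /degree (bigD1 j) //= ltr_wpDr ?weight_gt0 // sumr_ge0 // => l _.
exact: weight_ge0.
Qed.

Lemma volume_gt0 : 0 < V.
Proof.
have n_gt0 : (0 < n)%N by apply: ltnW.
rewrite (bigD1 (Ordinal n_gt0)) //= ltr_wpDr ?degree_gt0 // sumr_ge0 // => l _.
exact: ltW (degree_gt0 l).
Qed.

Lemma transition_mxE i j : P i j = c i j / k i.
Proof.
have Du : degree_mx G \in unitmx.
  rewrite unitmxE det_diag unitfE; apply/prodf_neq0 => l _.
  by rewrite mxE gt_eqF ?degree_gt0.
suff -> : P = \matrix_(i, j) (c i j / k i) by rewrite mxE.
apply: (canLR (mulKmx Du)); apply/matrixP => a b.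
by rewrite mul_diag_mx !mxE mulrC divfK // gt_eqF ?degree_gt0.
Qed.

Lemma transition_mx_ge0 i j : 0 <= P i j.
Proof. by rewrite transition_mxE divr_ge0 ?weight_ge0 // ltW ?degree_gt0. Qed.

Lemma transition_mx_sum1 i : \sum_j P i j = 1.
Proof.
under eq_bigr do rewrite transition_mxE.
by rewrite -mulr_suml divff // gt_eqF ?degree_gt0.
Qed.

Lemma dirichlet_form (x : 'I_n -> R) :
  \sum_i x i * (k i * x i - \sum_j c i j * x j) =
  2^-1 * \sum_i \sum_j c i j * (x i - x j) ^+ 2.
Proof.
have sq : \sum_i \sum_j c i j * x j ^+ 2 = \sum_i k i * x i ^+ 2.
  rewrite exchange_big; apply: eq_bigr => i _; rewrite -mulr_suml.
  by congr (_ * _); apply: eq_bigr => j _; apply: weight_sym.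
have sq' : \sum_i \sum_j c i j * x i ^+ 2 = \sum_i k i * x i ^+ 2.
  by apply: eq_bigr => i _; rewrite -mulr_suml.
have -> : \sum_i \sum_j c i j * (x i - x j) ^+ 2 =
    \sum_i \sum_j c i j * x i ^+ 2 + \sum_i \sum_j c i j * x j ^+ 2
    - 2 * \sum_i \sum_j x i * (c i j * x j).
  rewrite mulr_sumr -big_split -sumrB; apply: eq_bigr => i _ /=.
  rewrite mulr_sumr -big_split -sumrB; apply: eq_bigr => j _ /=; ring.
rewrite sq sq'.
have -> : \sum_i x i * (k i * x i - \sum_j c i j * x j) =
    \sum_i k i * x i ^+ 2 - \sum_i \sum_j x i * (c i j * x j).
  rewrite -sumrB; apply: eq_bigr => i _; rewrite -mulr_sumr; ring.
lra.
Qed.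

Lemma dirichlet_form_ge0 (x : 'I_n -> R) :
  0 <= \sum_i x i * (k i * x i - \sum_j c i j * x j).
Proof.
rewrite dirichlet_form mulr_ge0 ?invr_ge0 // sumr_ge0 // => i _.
by rewrite sumr_ge0 // => j _; rewrite mulr_ge0 ?weight_ge0 ?sqr_ge0.
Qed.

(** Zero energy forces [x] to agree across every edge, and connectedness propagates this along
    paths. *)
Lemma dirichlet_form_eq0 (x : 'I_n -> R) :
  \sum_i x i * (k i * x i - \sum_j c i j * x j) = 0 -> forall i j, x i = x j.
Proof.
rewrite dirichlet_form => /eqP; rewrite mulf_eq0 invr_eq0 pnatr_eq0 /=.
move=> /eqP E0; have t0 i j : 0 <= c i j * (x i - x j) ^+ 2.
  by rewrite mulr_ge0 ?weight_ge0 ?sqr_ge0.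
have xe i j : edge G i j -> x i = x j.
  move=> eij; apply/eqP; rewrite -subr_eq0 -sqrf_eq0.
  have := psumr_eq0P (fun i _ => sumr_ge0 _ (fun j _ => t0 i j)) E0.
  move=> /(_ i isT) /(psumr_eq0P (fun j _ => t0 i j)) /(_ j isT) /eqP.
  by rewrite mulf_eq0 gt_eqF ?weight_gt0.
move=> i j; have /connectP[p pp ->] := Gconn i j.
elim: p i pp => //= l p IH i /andP[/xe -> /IH //].
Qed.

Lemma harmonic_const (x : 'I_n -> R) :
  (forall i, \sum_j P i j * x j = x i) -> forall i j, x i = x j.
Proof.
move=> hx; apply: dirichlet_form_eq0; apply: big1 => i _.
suff -> : \sum_j c i j * x j = k i * x i by rewrite subrr mulr0.
rewrite -hx mulr_sumr; apply: eq_bigr => j _.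
by rewrite transition_mxE mulrA mulrCA divff ?mulr1 // gt_eqF ?degree_gt0.
Qed.

Lemma degree_stationary j : \sum_i k i * P i j = k j.
Proof.
apply: eq_bigr => i _; rewrite transition_mxE weight_sym.
by rewrite mulrCA divff ?mulr1 // gt_eqF ?degree_gt0.
Qed.

(** By reversibility, dividing a stationary distribution by the degrees gives a harmonic function,
    which is constant; normalization fixes the constant. *)
Lemma stationary_distributionE i : stationary_distribution P 0 i = k i / V.
Proof.
have V0 := volume_gt0.
rewrite /stationary_distribution; case: xgetP => [pi _ /=|/(_ (\row_i (k i / V)))].
  case=> pi_ge0 pi1 piP.
  pose x l := pi 0 l / k l.
  have xE l : pi 0 l = k l * x l.
    by rewrite /x mulrC divfK // gt_eqF ?degree_gt0.
  have xc : forall a b, x a = x b.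
    apply: harmonic_const => a; rewrite {2}/x -{1}piP mxE mulr_suml.
    apply: eq_bigr => b _; rewrite !transition_mxE /x weight_sym.
    ring.
  have : \sum_l k l * x i = 1.
    by rewrite -[RHS]pi1; apply: eq_bigr => l _; rewrite xE (xc l i).
  rewrite -mulr_suml xE => /(canRL (mulKf (lt0r_neq0 V0))) ->.
  by rewrite mulr1.
(* The default value of [xget] is ruled out by checking that [k i / V] is stationary. *)
case; split => [l||].
- by rewrite mxE divr_ge0 // ltW ?degree_gt0.
- under eq_bigr do rewrite mxE.
  by rewrite -mulr_suml divff ?gt_eqF.
- apply/rowP => l; rewrite !mxE -[in RHS]degree_stationary mulr_suml.
  by apply: eq_bigr => a _; rewrite mxE mulrAC.
Qed.

(** The first-step equations form a square linear system. Its homogeneous version has only the zero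
    solution by the Dirichlet form, and a minimum principle gives nonnegativity. *)
Lemma hitting_time i : exists2 h : 'I_n -> R,
  forall j, 0 <= h j & forall j, h j = 1 + taboo P i h j.
Proof.
pose A := \matrix_(a, b) ((a == b)%:R - (if a == i then 0 else P b a)).
have AE (x : 'rV[R]_n) j : (x *m A) 0 j = x 0 j - taboo P i (x 0) j.
  rewrite mxE; under eq_bigr do rewrite mxE mulrBr.
  rewrite sumrB (bigD1 j) //= eqxx mulr1 big1 ?addr0; last first.
    by move=> a /negPf->; rewrite mulr0.
  congr (_ - _); rewrite /taboo [RHS]big_mkcond /=; apply: eq_bigr => a _.
  by case: eqP => _; rewrite ?mulr0 //= mulrC.
have Au : A \in unitmx.
  rewrite -row_free_unit -kermx_eq0; apply/eqP/row_matrixP => r.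
  rewrite row0; set x := row r _.
  have xA : x *m A = 0.
    by apply/sub_kermxP; apply: row_sub.
  have xE j : x 0 j = taboo P i (x 0) j.
    by apply/eqP; rewrite -subr_eq0 -AE xA mxE.
  (* Each energy term of [y] vanishes: at [i] because [y i = 0], elsewhere because [y] is harmonic
     there. So [y] is constant, equal to its value 0 at [i]. *)
  pose y j := if j == i then 0 else x 0 j.
  have yE j : taboo P i (x 0) j = \sum_l P j l * y l.
    rewrite /taboo big_mkcond; apply: eq_bigr => l _ /=.
    by rewrite /y; case: eqP; rewrite ?mulr0.
  have yc : forall a b, y a = y b.
    apply: dirichlet_form_eq0; apply: big1 => j _.
    have [->|ji] := eqVneq j i; first by rewrite /y eqxx mul0r.
    apply/eqP; rewrite mulf_eq0 subr_eq0; apply/orP; right; apply/eqP.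
    rewrite {1}/y (negPf ji) xE yE mulr_sumr; apply: eq_bigr => l _.
    by rewrite transition_mxE mulrA mulrCA divff ?mulr1 // gt_eqF ?degree_gt0.
  have y0 j : y j = 0 by rewrite (yc j i) /y eqxx.
  apply/rowP => j; rewrite [RHS]mxE xE yE big1 // => l _.
  by rewrite y0 mulr0.
pose h := const_mx 1 *m invmx A : 'rV[R]_n.
have hE j : h 0 j = 1 + taboo P i (h 0) j.
  by apply/eqP; rewrite -subr_eq -AE /h mulmxKV // mxE.
exists (h 0) => // j.
(* Were the minimum negative, the row sums of the taboo operator, being at most 1, would give
   [taboo P i (h 0) m >= h 0 m], contradicting the equation at [m]. *)
pose m := [arg min_(l < i) h 0 l]%O.
have hm l : h 0 m <= h 0 l by rewrite /m; case: arg_minP => // a _; apply.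
apply: le_trans (hm j); rewrite leNgt; apply/negP => m0.
suff : 1 + h 0 m <= h 0 m by rewrite gerDr ler10.
rewrite [leRHS]hE lerD2l /taboo.
apply: (@le_trans _ _ (\sum_(l | l != i) P m l * h 0 m)); last first.
  by apply: ler_sum => l _; rewrite ler_wpM2l ?transition_mx_ge0.
rewrite -mulr_suml -[leLHS]mul1r; apply: ler_wnM2r; first exact: ltW.
rewrite -(transition_mx_sum1 m) [leRHS](bigID (fun l => l != i)) /= lerDl.
by apply: sumr_ge0 => l _; apply: transition_mx_ge0.
Qed.

End Potential.

(** * Kemeny's constant as a weighted trace of an inverse matrix *)

Section Resolvent.
Variables (R : realType) (n : nat) (G : wgraph R n).
Hypotheses (n_ge2 : (2 <= n)%N) (Gconn : connected_graph G).
Local Notation c := (weight G).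
Local Notation k := (degree G).
Local Notation P := (transition_mx G).
Local Notation V := (\sum_i degree G i).

Let V_gt0 : 0 < V := volume_gt0 n_ge2 Gconn.
Let k_gt0 i : 0 < k i := degree_gt0 n_ge2 Gconn i.
Let V_neq0 : V != 0. Proof. by rewrite gt_eqF. Qed.
Let k_neq0 i : k i != 0. Proof. by rewrite gt_eqF. Qed.

Lemma degree_transition_mx i j : k i * P i j = c i j.
Proof.
by rewrite (transition_mxE n_ge2 Gconn) mulrCA divff ?mulr1.
Qed.

(* [D^(1/2) (I - M_G + t v v^T) D^(1/2)], where [v_i = sqrt (k_i / V)] is the
   Perron eigenvector of the normalized adjacency matrix [M_G]. *)
Definition shifted_laplacian (t : R) : 'M[R]_n :=
  \matrix_(i, j) ((i == j)%:R * k i - c i j + t / V * (k i * k j)).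

Lemma shifted_laplacian_sym t : (shifted_laplacian t)^T = shifted_laplacian t.
Proof.
apply/matrixP => i j; rewrite !mxE weight_sym eq_sym [k j * k i]mulrC.
by case: eqP => [->//|_]; rewrite !mul0r.
Qed.

Lemma shifted_laplacian_mul t (x : 'I_n -> R) i :
  \sum_j shifted_laplacian t i j * x j =
  k i * x i - \sum_j c i j * x j + t / V * k i * \sum_j k j * x j.
Proof.
under eq_bigr do rewrite mxE mulrDl mulrBl.
rewrite big_split sumrB /=; congr (_ - _ + _).
  rewrite (bigD1 i) //= eqxx mul1r big1 ?addr0 // => j.
  by rewrite eq_sym => /negPf ->; rewrite !mul0r.
by rewrite mulr_sumr; apply: eq_bigr => j _; rewrite !mulrA.
Qed.

Lemma shifted_laplacian_form t (x : 'I_n -> R) :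
  \sum_i x i * (\sum_j shifted_laplacian t i j * x j) =
  \sum_i x i * (k i * x i - \sum_j c i j * x j)
  + t / V * (\sum_j k j * x j) ^+ 2.
Proof.
under eq_bigr do rewrite shifted_laplacian_mul mulrDr.
rewrite big_split /=; congr (_ + _).
rewrite expr2 mulrA [RHS]mulr_sumr; apply: eq_bigr => i _; ring.
Qed.

Lemma shifted_laplacian_ge0 t (x : 'I_n -> R) : 0 <= t ->
  0 <= \sum_i x i * (\sum_j shifted_laplacian t i j * x j).
Proof.
move=> t0; rewrite shifted_laplacian_form addr_ge0 ?dirichlet_form_ge0 //.
by rewrite mulr_ge0 ?sqr_ge0 // divr_ge0 // ltW.
Qed.

(** The Laplacian part vanishes only on constants, and the rank-one part is positive on nonzero
    constants. *)
Lemma shifted_laplacian_eq0 t (x : 'I_n -> R) : 0 < t ->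
  \sum_i x i * (\sum_j shifted_laplacian t i j * x j) = 0 -> forall i, x i = 0.
Proof.
move=> t0; have tV : 0 < t / V by rewrite divr_gt0.
rewrite shifted_laplacian_form => /eqP.
rewrite paddr_eq0 ?dirichlet_form_ge0 ?(mulr_ge0 (ltW tV)) ?sqr_ge0 //.
case/andP=> /eqP/(dirichlet_form_eq0 Gconn) xc.
rewrite mulf_eq0 (gt_eqF tV) /= sqrf_eq0 => /eqP kx0 i.
apply: (mulfI V_neq0); rewrite mulr0 -[RHS]kx0 mulr_suml.
by apply: eq_bigr => j _; rewrite (xc j i).
Qed.

(** With [m0] the passage times with zeroed diagonal, the first-step equations read
    [(D - A) m0 = k 1^T - V I]. Hence [- m0 / V] inverts [D - A] up to a rank-one error, and a
    constant added to each column absorbs it. *)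
Lemma kemeny_trace t : t != 0 -> exists (K : R) (Z : 'M[R]_n),
  [/\ forall j, kemeny G j = K%:E, shifted_laplacian t *m Z = 1%:M &
      \sum_i k i * Z i i = K + t^-1].
Proof.
move=> t0.
have /boolp.choice[h hP] : forall i, exists h : 'I_n -> R,
    (forall j, 0 <= h j) /\ forall j, h j = 1 + taboo P i h j.
  by move=> i; have [h h0 hE] := hitting_time n_ge2 Gconn i; exists h.
pose m j i := h i j.
pose m0 j i := if j == i then 0 else m j i.
have mfpE j i : mean_first_passage P j i = (m j i)%:E.
  have [h0 hE] := hP i; apply: mean_first_passageE => //.
  - exact: transition_mx_ge0.
  - exact: transition_mx_sum1.
have mE j i : m j i = 1 + \sum_l P j l * m0 l i.
  rewrite /m (hP i).2; congr (_ + _); rewrite /taboo big_mkcond.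
  by apply: eq_bigr => l _; rewrite /m0; case: eqP; rewrite ?mulr0.
have m0E j i : m0 j i = m j i - (j == i)%:R * m j i.
  by rewrite /m0; case: eqP; rewrite ?mul1r ?subrr ?mul0r ?subr0.
(* Kac's return time formula: average the first-step equations against the degrees, which are
   stationary. *)
have mii i : k i * m i i = V.
  have : \sum_j k j * m j i = V + \sum_l k l * m0 l i.
    transitivity (\sum_j (k j + \sum_l k j * P j l * m0 l i)).
      apply: eq_bigr => j _; rewrite mE mulrDr mulr1 mulr_sumr.
      by congr (_ + _); apply: eq_bigr => l _; rewrite mulrA.
    rewrite big_split; congr (_ + _); rewrite exchange_big.
    apply: eq_bigr => l _ /=.
    by rewrite -mulr_suml (degree_stationary n_ge2 Gconn).
  have -> : \sum_l k l * m0 l i = \sum_l k l * m l i - k i * m i i.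
    under eq_bigr do rewrite m0E mulrBr.
    rewrite sumrB [X in _ - X](bigD1 i) //= eqxx mul1r.
    rewrite [X in _ - (_ + X)]big1 ?addr0 // => j /negPf->.
    by rewrite mul0r mulr0.
  lra.
(* [kap j / V] is Kemeny's constant: by [mii] the return time terms total 1, cancelling the [- 1] in
   [kemeny]. It is independent of [j] because [kap] is harmonic. *)
pose kap j := \sum_i k i * m0 j i.
have kapE j : \sum_i k i * m j i = kap j + V.
  rewrite /kap; under [in RHS]eq_bigr do rewrite m0E mulrBr.
  rewrite sumrB [X in _ - X](bigD1 j) //= eqxx mul1r mii.
  rewrite [X in _ - (_ + X)]big1 => [|i]; first by rewrite addr0 subrK.
  by rewrite eq_sym => /negPf->; rewrite mul0r mulr0.
have kapc : forall a b, kap a = kap b.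
  apply: (harmonic_const n_ge2 Gconn) => j.
  apply: (addIr V); rewrite -kapE.
  under [RHS]eq_bigr do rewrite mE mulrDr mulr1 mulr_sumr.
  rewrite big_split /= [RHS]addrC; congr (_ + _); rewrite [RHS]exchange_big /=.
  apply: eq_bigr => l _; rewrite /kap mulr_sumr; apply: eq_bigr => i _; ring.
have [j0] : exists j : 'I_n, true by exists (Ordinal (ltnW n_ge2)).
exists (kap j0 / V).
(* [mu i] is the stationary mean of column [i] of [m0]; adding [t^-1 + mu i] makes the
   degree-weighted sum of each column of [Z] equal to [t^-1], as the rank-one term demands. *)
pose mu i := V^-1 * \sum_l k l * m0 l i.
exists (\matrix_(j, i) (V^-1 * (t^-1 + mu i - m0 j i))); split.
- move=> j; rewrite /kemeny.
  under eq_bigr do rewrite (stationary_distributionE n_ge2 Gconn) mfpE -EFinM.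
  rewrite sumEFin -EFinB; congr (_%:E).
  rewrite (kapc j0 j) -[kap j](addrK V) -kapE mulrBl divff // mulr_suml.
  by congr (_ - _); apply: eq_bigr => i _; rewrite mulrAC.
- apply/matrixP => j i; rewrite [LHS]mxE [RHS]mxE.
  under eq_bigr do rewrite [X in _ * X]mxE.
  rewrite shifted_laplacian_mul; set w := t^-1 + mu i.
  have -> : \sum_l k l * (V^-1 * (w - m0 l i)) = t^-1.
    transitivity (V^-1 * (V * w - \sum_l k l * m0 l i)).
      rewrite mulr_suml -sumrB mulr_sumr; apply: eq_bigr => l _; ring.
    by rewrite mulrBr mulKf // /w addrK.
  have -> : \sum_l c j l * (V^-1 * (w - m0 l i)) =
      V^-1 * (k j * w - k j * (m j i - 1)).
    rewrite mE [1 + _]addrC addrK mulr_suml mulr_sumr -sumrB mulr_sumr.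
    by apply: eq_bigr => l _; rewrite -degree_transition_mx; ring.
  rewrite m0E; have [->|_] := eqVneq j i.
    have -> : m i i = V / k i by rewrite -(mii i) mulrAC divff ?mul1r.
    by field; rewrite t0 V_neq0 k_neq0.
  by rewrite mul0r /=; field; rewrite t0 V_neq0.
- transitivity (\sum_i k i * (V^-1 * t^-1) + V^-1 * \sum_i k i * mu i).
    rewrite mulr_sumr -big_split; apply: eq_bigr => i _ /=.
    by rewrite mxE /m0 eqxx; ring.
  rewrite -mulr_suml mulVKf // addrC; congr (_ + _).
  rewrite mulrC; congr (_ / _).
  transitivity (V^-1 * \sum_l k l * kap l).
    rewrite mulr_sumr.
    under [RHS]eq_bigr do rewrite /kap mulr_sumr mulr_sumr.
    rewrite [RHS]exchange_big /=; apply: eq_bigr => i _.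
    rewrite /mu mulr_sumr mulr_sumr; apply: eq_bigr => l _; ring.
  rewrite -[RHS](mulKf V_neq0); congr (_ * _); rewrite mulr_suml.
  by apply: eq_bigr => l _; rewrite (kapc l j0).
Qed.

End Resolvent.

(** * The lower bound attached to a proper colouring *)

Section ColorBound.
Variables (R : realType) (n : nat) (G : wgraph R n) (r : nat) (f : 'I_n -> 'I_r).
Hypotheses (n_ge2 : (2 <= n)%N) (Gconn : connected_graph G).
Hypothesis f_proper : forall i j, edge G i j -> f i != f j.
Local Notation c := (weight G).
Local Notation k := (degree G).
Local Notation V := (\sum_i degree G i).

Definition color_volume (a : 'I_r) : R := \sum_(i | f i == a) k i.

Let V_gt0 : 0 < V := volume_gt0 n_ge2 Gconn.
Let k_gt0 i : 0 < k i := degree_gt0 n_ge2 Gconn i.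
Let V_neq0 : V != 0. Proof. by rewrite gt_eqF. Qed.
Let k_neq0 i : k i != 0. Proof. by rewrite gt_eqF. Qed.

Lemma color_volume_ge0 a : 0 <= color_volume a.
Proof. by apply: sumr_ge0 => i _; apply: ltW. Qed.

Lemma sum_color_volume : \sum_a color_volume a = V.
Proof. by rewrite [RHS](partition_big f xpredT). Qed.

Lemma weight_same_color i j : f i = f j -> c i j = 0.
Proof.
by move=> fij; apply: weight_eq0; apply/negP => /f_proper; rewrite fij eqxx.
Qed.

Definition block_diagonal (t : R) : 'M[R]_n :=
  \matrix_(i, j) ((f i == f j)%:R * shifted_laplacian G t i j).

(* Sherman-Morrison applied to each diagonal block. *)
Definition block_inverse (t : R) : 'M[R]_n :=
  \matrix_(i, j) ((i == j)%:R / k i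
    - (f i == f j)%:R * (t / (V + t * color_volume (f i)))).

Section Shift.
Variables (t : R) (t_gt0 : 0 < t).
Local Notation B := (shifted_laplacian G t).
Local Notation Bd := (block_diagonal t).
Local Notation Y := (block_inverse t).

Let Vt_gt0 a : 0 < V + t * color_volume a.
Proof. by rewrite ltr_wpDr // mulr_ge0 ?color_volume_ge0 // ltW. Qed.

Lemma block_inverse_off i j : f i != f j -> Y i j = 0.
Proof.
move=> fij; rewrite mxE (negPf fij) mul0r subr0.
by have [ij|_] := eqVneq i j; [rewrite ij eqxx in fij|rewrite mul0r].
Qed.

Lemma block_inverse_degree j :
  \sum_l k l * Y l j = V / (V + t * color_volume (f j)).
Proof.
set s := t / (V + t * color_volume (f j)).
transitivity (\sum_l ((l == j)%:R - (if f l == f j then k l else 0) * s)).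
  apply: eq_bigr => l _; rewrite mxE mulrBr mulrCA divff // mulr1.
  have [flj|_] := eqVneq (f l) (f j); last by rewrite !mul0r mulr0.
  by rewrite flj mul1r.
rewrite sumrB -mulr_suml -big_mkcond -/(color_volume (f j)).
rewrite (bigD1 j) //= eqxx big1 ?addr0 => [|l /negPf->//].
by rewrite /s /=; field; rewrite gt_eqF.
Qed.

Lemma block_diagonalK : Bd *m Y = 1%:M.
Proof.
apply/matrixP => i j; rewrite [LHS]mxE [RHS]mxE.
have [fij|fij] := eqVneq (f i) (f j); last first.
  have [ij|_] := eqVneq i j; first by rewrite ij eqxx in fij.
  rewrite big1 // => l _.
  rewrite mxE; have [fil|_] := eqVneq (f i) (f l); last by rewrite !mul0r.
  by rewrite block_inverse_off ?mulr0 // -fil.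
transitivity (\sum_l ((l == i)%:R * (k i * Y i j) + t / V * k i * (k l * Y l j))).
  apply: eq_bigr => l _; have [fil|fil] := eqVneq (f i) (f l).
    rewrite [Bd i l]mxE fil eqxx mxE weight_same_color //.
    by have [->|_] := eqVneq i l; rewrite ?mul1r ?mul0r; ring.
  have -> : Y l j = 0 by rewrite block_inverse_off // -fij eq_sym.
  have -> : (l == i) = false by apply: contraNF fil => /eqP->.
  by rewrite !(mul0r, mulr0) addr0.
rewrite big_split -mulr_sumr block_inverse_degree /=.
rewrite (bigD1 i) //= eqxx big1 ?addr0 => [|l /negPf->]; last by rewrite mul0r.
rewrite mxE fij eqxx !mul1r; field.
by rewrite V_neq0 k_neq0 gt_eqF.
Qed.

Lemma block_inverse_sym : Y^T = Y.
Proof.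
apply/matrixP => i j; rewrite !mxE eq_sym [f j == _]eq_sym.
have [->//|_] := eqVneq i j; rewrite !mul0r.
by have [->|_] := eqVneq (f i) (f j); rewrite ?mul0r.
Qed.

(** Row and column [i] of [Y] are supported on one colour class, so this entry sees only a diagonal
    block of [B], which [Y] inverts. *)
Lemma block_inverse_form i : (Y *m B *m Y) i i = Y i i.
Proof.
have -> : (Y *m B *m Y) i i = (Y *m Bd *m Y) i i.
  rewrite -!mulmxA !mxE; apply: eq_bigr => j _.
  have [fij|/block_inverse_off ->] := eqVneq (f i) (f j); last by rewrite !mul0r.
  congr (_ * _); rewrite !mxE; apply: eq_bigr => l _.
  have [fli|/block_inverse_off ->] := eqVneq (f l) (f i); last by rewrite !mulr0.
  by rewrite [Bd _ _]mxE fli fij eqxx mul1r.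
by rewrite -mulmxA block_diagonalK mulmx1.
Qed.

(** Expanding [(Z - Y)^T B (Z - Y)] gives [Z^T - Y - Y + Y B Y], and on the diagonal the last term
    cancels one [Y]. The pinching gap is thus a value of the form of [B]. *)
Lemma resolvent_sub_block_inverse (Z : 'M[R]_n) i : B *m Z = 1%:M ->
  Z i i - Y i i = \sum_j (Z - Y) j i * (\sum_l B j l * (Z - Y) l i).
Proof.
move=> BZ.
have ZTB : Z^T *m B = 1%:M.
  by rewrite -[B]shifted_laplacian_sym -trmx_mul BZ trmx1.
have E : (Z - Y)^T *m (B *m (Z - Y)) = Z^T - Y - Y + Y *m B *m Y.
  rewrite mulmxBr BZ [(Z - Y)^T]linearB /= block_inverse_sym mulmxBr mulmx1 mulmxBl.
  rewrite !mulmxA ZTB mul1mx opprB addrA.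
  exact: addrAC.
have := congr1 (fun M : 'M[R]_n => M i i) E.
rewrite [X in _ = X -> _]mxE block_inverse_form.
rewrite [X in _ = X + _ -> _]mxE [X in _ = X + _ + _ -> _]mxE.
rewrite [Z^T i i]mxE [(- Y) i i]mxE subrK => <-; rewrite mxE.
by apply: eq_bigr => j _; rewrite [_^T i j]mxE [(B *m _) j i]mxE.
Qed.

Lemma block_inverse_le (Z : 'M[R]_n) i : B *m Z = 1%:M -> Y i i <= Z i i.
Proof.
move=> BZ; rewrite -subr_ge0 (resolvent_sub_block_inverse _ BZ).
by rewrite (shifted_laplacian_ge0 n_ge2 Gconn) // ltW.
Qed.

(** Positive definiteness kills every column of [Z - Y], so [B] and [Bd] share an inverse. *)
Lemma block_inverse_eq (Z : 'M[R]_n) : B *m Z = 1%:M ->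
  (forall i, Z i i = Y i i) -> B = Bd.
Proof.
move=> BZ ZY; suff ZE : Z = Y.
  by rewrite -[LHS]mulmx1 -(mulmx1C block_diagonalK) -ZE mulmxA BZ mul1mx.
apply/matrixP => j i; apply/eqP; rewrite -subr_eq0; apply/eqP.
have := resolvent_sub_block_inverse i BZ; rewrite ZY subrr => /esym.
by move/(shifted_laplacian_eq0 n_ge2 Gconn t_gt0)/(_ j); rewrite !mxE.
Qed.

Lemma trace_block_inverse :
  \sum_i k i * Y i i = n%:R - \sum_a (1 - V / (V + t * color_volume a)).
Proof.
transitivity (\sum_(i < n) (1 - t * k i / (V + t * color_volume (f i)))).
  apply: eq_bigr => i _; rewrite mxE !eqxx mul1r mulrBr divff // mul1r.
  by rewrite mulrCA mulrA.
rewrite sumrB sumr_const card_ord; congr (_ - _).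
rewrite (partition_big f xpredT) //=; apply: eq_bigr => a _.
transitivity (\sum_(i | f i == a) k i * (t / (V + t * color_volume a))).
  by apply: eq_bigr => i /eqP->; rewrite [t * _]mulrC mulrA.
rewrite -mulr_suml -/(color_volume a).
by field; rewrite gt_eqF.
Qed.

End Shift.

(** The equality condition of the bound; equal colour volumes are a consequence of it. *)
Definition equitable :=
  forall i j, f i != f j -> c i j = r%:R / (r%:R - 1) / V * (k i * k j).

Section Bound.
Hypothesis r_ge2 : (2 <= r)%N.
Let t : R := r%:R / (r%:R - 1).

Let r1_gt0 : 0 < r%:R - 1 :> R.
Proof. by rewrite subr_gt0 ltr1n. Qed.

Let r_gt0 : 0 < r%:R :> R.
Proof. by rewrite ltr0n ltnW. Qed.

Let t_gt0 : 0 < t. Proof. by rewrite divr_gt0. Qed.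

Let Vt_gt0 a : 0 < V + t * color_volume a.
Proof. by rewrite ltr_wpDr // mulr_ge0 ?color_volume_ge0 // ltW. Qed.

(** The added sum is the exact error of replacing [V / u], with [u = V + t * color_volume a], by its
    tangent at [u = t * V]. For this [t] the tangency point is the volume [V / r], and the tangent
    values of the summands [1 - V / u] add up to 1. *)
Lemma trace_block_inverse_gap :
  \sum_i k i * block_inverse t i i = n%:R - 1 +
  \sum_a (V + t * color_volume a - t * V) ^+ 2
           / (t ^+ 2 * V * (V + t * color_volume a)).
Proof.
rewrite trace_block_inverse //.
have Vt a : V + t * color_volume a != 0 by rewrite gt_eqF.
have t0 : t != 0 by rewrite gt_eqF.
have -> : \sum_a (V + t * color_volume a - t * V) ^+ 2
           / (t ^+ 2 * V * (V + t * color_volume a)) =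
  \sum_(a < r) (1 - 2 / t + t ^- 2) + (t * V)^-1 * \sum_a color_volume a
  - \sum_a (1 - V / (V + t * color_volume a)).
  rewrite [_^-1 * _]mulr_sumr -big_split -sumrB; apply: eq_bigr => a _ /=.
  by field; rewrite t0 V_neq0 Vt.
rewrite sum_color_volume sumr_const card_ord -mulr_natl.
rewrite addrA; congr (_ - _).
rewrite /t; field.
by rewrite !gt_eqF.
Qed.

(** Summing the equitable relation over the neighbours of a vertex determines the volume of its
    colour. *)
Lemma equitable_color_volume : equitable -> forall a, color_volume a = V / r%:R.
Proof.
move=> eqf.
have used i : color_volume (f i) = V / r%:R.
  have : k i = t / V * (k i * (V - color_volume (f i))).
    rewrite {1}/degree (bigID (fun j => f i != f j)) /=.
    rewrite [X in _ + X]big1 ?addr0 => [|j]; last first.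
      by rewrite negbK => /eqP/weight_same_color.
    have -> : V - color_volume (f i) = \sum_(j | f j != f i) k j.
      by apply: (canLR (addrK _)); rewrite addrC; apply: bigID.
    rewrite [k i * _]mulr_sumr [_ / _ * _]mulr_sumr.
    by apply: eq_big => [j|j /eqf //]; rewrite eq_sym.
  set x := color_volume _ => kE.
  have VE : V = t * (V - x).
    by apply: (mulfI (k_neq0 i)); rewrite [X in X * _ = _]kE; field.
  have rx : V * (r%:R - 1) = r%:R * (V - x).
    by rewrite [X in X * _]VE /t; field; rewrite gt_eqF.
  apply: (mulfI (lt0r_neq0 r_gt0)).
  by rewrite [RHS]mulrCA divff ?gt_eqF //; lra.
(* A colour not yet known to occur has volume 0 at worst; the deficits are nonnegative and sum to 0,
   so all vanish. *)
have le a : 0 <= V / r%:R - color_volume a.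
  have [[i /eqP <-]|none] := pselect (exists i, f i == a).
    by rewrite used subrr.
  rewrite [color_volume a]big1 ?subr0 => [|i fi]; last by case: none; exists i.
  by rewrite divr_ge0 // ltW.
have S0 : \sum_a (V / r%:R - color_volume a) = 0.
  rewrite sumrB sum_color_volume sumr_const card_ord -[_ / _ *+ _]mulr_natl.
  by rewrite mulrCA divff ?mulr1 ?subrr // gt_eqF.
by move=> a; have /subr0_eq := psumr_eq0P (fun a _ => le a) S0 (i := a) isT.
Qed.

(** Since [t^-1 = 1 - 1 / r], the bound combines the pinching inequality with the trace gap. It
    allows any proper colouring, so the converse can use one read off from the given structure. *)
Lemma kemeny_coloring_bound : exists K : R,
  [/\ forall j, kemeny G j = K%:E, n%:R - 2 + 1 / r%:R <= K &
      K = n%:R - 2 + 1 / r%:R <-> equitable].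
Proof.
have t0 : t != 0 by rewrite gt_eqF.
have [K [Z [KE BZ KZ]]] := kemeny_trace n_ge2 Gconn t0.
have tV : t^-1 = 1 - 1 / r%:R.
  by rewrite /t; field; rewrite !gt_eqF.
have YZ i : k i * block_inverse t i i <= k i * Z i i.
  by rewrite ler_wpM2l ?block_inverse_le // ltW.
have gap_ge0 : 0 <= \sum_a (V + t * color_volume a - t * V) ^+ 2
           / (t ^+ 2 * V * (V + t * color_volume a)).
  apply: sumr_ge0 => a _; apply: divr_ge0; first exact: sqr_ge0.
  by apply: mulr_ge0 (ltW (Vt_gt0 _)); rewrite mulr_ge0 ?sqr_ge0 // ltW.
have KY : \sum_i k i * block_inverse t i i <= K + t^-1.
  by rewrite -KZ ler_sum.
have gapE := trace_block_inverse_gap.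
exists K; split => //.
  by rewrite gapE in KY; lra.
split => [KEq|eqf].
  (* The pinching gap and the trace gap are both nonnegative and now sum to 0. *)
  have YZ0 : \sum_i (k i * Z i i - k i * block_inverse t i i) = 0.
    by rewrite sumrB KZ; lra.
  have ZY i : Z i i = block_inverse t i i.
    apply: (mulfI (k_neq0 i)); apply: subr0_eq.
    apply: (psumr_eq0P _ YZ0) => // j _; by rewrite subr_ge0.
  have BBd := block_inverse_eq t_gt0 BZ ZY.
  move=> i j fij; have := congr1 (fun M : 'M[R]_n => M i j) BBd.
  rewrite [RHS]mxE (negPf fij) mul0r mxE.
  have [ij|_] := eqVneq i j; first by rewrite ij eqxx in fij.
  rewrite mul0r -/t; lra.
have vol := equitable_color_volume eqf.
have BBd : shifted_laplacian G t = block_diagonal t.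
  apply/matrixP => i j; rewrite [RHS]mxE.
  have [_|fij] := eqVneq (f i) (f j); first by rewrite mul1r.
  rewrite mul0r mxE (eqf _ _ fij) -/t.
  have [ij|_] := eqVneq i j; first by rewrite ij eqxx in fij.
  by rewrite mul0r sub0r addNr.
have ZE : Z = block_inverse t.
  by rewrite -[LHS]mul1mx -(mulmx1C (block_diagonalK t_gt0)) -mulmxA -BBd BZ mulmx1.
move: KZ; rewrite ZE gapE big1 => [|a _]; first by lra.
rewrite vol (_ : V + _ - _ = 0) ?expr0n ?mul0r //.
by rewrite /t; field; rewrite !gt_eqF.
Qed.

End Bound.
End ColorBound.

(** * Equality for unweighted graphs: complete multipartite structure *)

Section CompleteMultipartite.
Variables (R : realType) (n : nat) (G : wgraph R n) (r : nat) (f : 'I_n -> 'I_r).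
Hypotheses (n_ge2 : (2 <= n)%N) (Gconn : connected_graph G).
Hypothesis unweightedG : unweighted G.
Local Notation c := (weight G).
Local Notation k := (degree G).
Local Notation V := (\sum_i degree G i).

Let V_gt0 : 0 < V := volume_gt0 n_ge2 Gconn.
Let k_gt0 i : 0 < k i := degree_gt0 n_ge2 Gconn i.

Section Equitable.
Hypotheses (r_ge2 : (2 <= r)%N) (f_proper : forall i j, edge G i j -> f i != f j).
Hypothesis eqf : equitable G f.

Lemma equitable_edge i j : edge G i j = (f i != f j).
Proof.
apply/idP/idP => [/f_proper//|fij]; apply: contraLR isT => /weight_eq0 c0.
have := eqf fij; rewrite c0 => /esym/eqP.
have r1 : 0 < r%:R - 1 :> R by rewrite subr_gt0 ltr1n.
have r0 : 0 < r%:R :> R by rewrite ltr0n ltnW.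
by rewrite gt_eqF // mulr_gt0 ?divr_gt0 ?mulr_gt0.
Qed.

Lemma equitable_surj a : exists i, f i = a.
Proof.
have vol := equitable_color_volume n_ge2 Gconn f_proper r_ge2 eqf a.
have [[i fi]|none] := pselect (exists i, f i = a); first by exists i.
have : 0 < color_volume G f a.
  by rewrite vol divr_gt0 // ltr0n ltnW.
rewrite /color_volume big1 ?ltxx // => i /eqP fi.
by case: none; exists i.
Qed.

(** A vertex [l] of a third colour is adjacent to both [i] and [j], and its two unit weights give
    [k l * k i = k l * k j]. With two colours degrees may differ, as in unbalanced complete
    bipartite graphs. *)
Lemma equitable_degree : (3 <= r)%N -> forall i j, k i = k j.
Proof.
move=> r_ge3 i j.
have [a] : exists a, a \notin [:: f i; f j].
  apply/existsP; rewrite -negb_forall; apply: contraL r_ge3 => /forallP all2.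
  have : (#|'I_r| <= #|[:: f i; f j]|)%N.
    by apply/subset_leq_card/fintype.subsetP => a _; apply: all2.
  by rewrite card_ord -leqNgt => /leq_trans; apply; apply: card_size.
rewrite !inE negb_or => /andP[afi afj]; have [l fl] := equitable_surj a.
have eq1 x : f l != f x -> 1 = r%:R / (r%:R - 1) / V * (k l * k x) :> R.
  by move=> flx; rewrite -(eqf flx) unweightedG // equitable_edge.
have E : r%:R / (r%:R - 1) / V * (k l * k i) = r%:R / (r%:R - 1) / V * (k l * k j).
  by rewrite -!eq1 // fl.
have r1 : 0 < r%:R - 1 :> R by rewrite subr_gt0 ltr1n.
have r0 : 0 < r%:R :> R by rewrite ltr0n ltnW.
have tV : 0 < r%:R / (r%:R - 1) / V by rewrite !divr_gt0.
by apply: (mulfI (lt0r_neq0 (k_gt0 l))); apply: (mulfI (lt0r_neq0 tV)).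
Qed.

Lemma equitable_color_card : (3 <= r)%N -> forall a, (#|[pred i | f i == a]| * r = n)%N.
Proof.
move=> r_ge3 a; have i0 : 'I_n := Ordinal (ltnW n_ge2).
have := equitable_color_volume n_ge2 Gconn f_proper r_ge2 eqf a.
have -> : V = n%:R * k i0.
  rewrite (eq_bigr (fun=> k i0)) => [|i _]; last exact: equitable_degree.
  by rewrite sumr_const card_ord mulr_natl.
have -> : color_volume G f a = #|[pred i | f i == a]|%:R * k i0.
  rewrite /color_volume (eq_bigr (fun=> k i0)) => [|i _]; last exact: equitable_degree.
  by rewrite sumr_const mulr_natl.
move=> E; apply/eqP; rewrite -(eqr_nat R) natrM; apply/eqP.
apply: (mulIf (lt0r_neq0 (k_gt0 i0))).
by rewrite mulrAC E divfK // pnatr_eq0 -lt0n ltnW.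
Qed.

Lemma equitable_iso : (3 <= r)%N ->
  (r %| n)%N /\ graph_iso (edge G) (@balanced_multipartite r n).
Proof.
move=> r_ge3; have r_gt0 : (0 < r)%N by apply: ltnW.
have class_card a : #|[pred i | f i == a]| = (n %/ r)%N.
  by rewrite -(mulnK #|[pred i | f i == a]| r_gt0) equitable_color_card.
have rn : (r %| n)%N.
  by rewrite -(equitable_color_card r_ge3 (Ordinal r_gt0)) dvdn_mull.
split => //.
(* The rank of [i] within its colour class serves as the second coordinate of the isomorphism. *)
have lt i : (index i (enum [pred l | f l == f i]) < n %/ r)%N.
  by rewrite -(class_card (f i)) cardE index_mem mem_enum inE.
exists (fun i => (f i, Ordinal (lt i))) => [|i j]; last exact: equitable_edge.
apply: inj_card_bij => [i j [fij]|]; last first.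
  by rewrite card_prod !card_ord mulnC divnK.
by rewrite fij => /index_inj -> //; rewrite mem_enum inE ?fij.
Qed.

End Equitable.

Section Partition.
Hypothesis edgeE : forall i j, edge G i j = (f i != f j).

Definition color_card (a : 'I_r) : R := \sum_(i | f i == a) 1.

Lemma multipartite_weight i j : c i j = (f i != f j)%:R.
Proof.
have [fij|fij] := boolP (f i != f j).
  by rewrite unweightedG // edgeE.
by rewrite weight_eq0 // edgeE.
Qed.

Lemma multipartite_degree i : k i = n%:R - color_card (f i).
Proof.
rewrite /degree; under eq_bigr do rewrite multipartite_weight.
have -> : n%:R = \sum_(j < n) 1 :> R by rewrite sumr_const card_ord.
rewrite /color_card [X in _ - X]big_mkcond -sumrB; apply: eq_bigr => j _ /=.
by rewrite eq_sym; case: eqP; rewrite ?subrr ?subr0.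
Qed.

Lemma sum_color_card : \sum_a color_card a = n%:R.
Proof.
have -> : n%:R = \sum_(j < n) 1 :> R by rewrite sumr_const card_ord.
by rewrite [RHS](partition_big f xpredT).
Qed.

Lemma multipartite_volume :
  V = \sum_a color_card a * (n%:R - color_card a).
Proof.
rewrite (partition_big f xpredT) //=; apply: eq_bigr => a _.
rewrite [color_card a in X in X * _]/color_card mulr_suml.
by apply: eq_bigr => i /eqP fi; rewrite multipartite_degree fi mul1r.
Qed.

(** All degrees are [(r - 1) s] and the volume is [r (r - 1) s^2], so the prescribed weight is 1. *)
Lemma equitable_balanced s : (2 <= r)%N -> (forall a, color_card a = s) ->
  equitable G f.
Proof.
move=> r_ge2 cs i j fij.
have nE : n%:R = r%:R * s.
  rewrite -sum_color_card; under eq_bigr do rewrite cs.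
  by rewrite sumr_const card_ord mulr_natl.
have s0 : s != 0.
  apply: contraTneq n_ge2 => s0.
  by move/eqP: nE; rewrite s0 mulr0 pnatr_eq0 => /eqP ->.
have r1 : r%:R - 1 != 0 :> R by rewrite gt_eqF // subr_gt0 ltr1n.
have r0 : r%:R != 0 :> R by rewrite gt_eqF // ltr0n ltnW.
rewrite multipartite_weight fij !multipartite_degree multipartite_volume.
under eq_bigr do rewrite cs.
rewrite sumr_const card_ord -[_ * _ *+ r]mulr_natl !cs nE.
have -> : r%:R * s - s = (r%:R - 1) * s by ring.
by rewrite /=; field; rewrite s0 r1 r0.
Qed.

End Partition.
End CompleteMultipartite.

(** With class sizes [x] and [y] the degrees are [y] and [x] and the volume is [2 x y], so the
    prescribed weight [2 x y / V] is 1 even for unequal classes. *)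
Lemma equitable_bipartite (R : realType) (n : nat) (G : wgraph R n) (f : 'I_n -> 'I_2) :
  (2 <= n)%N -> connected_graph G -> unweighted G ->
  (forall i j, edge G i j = (f i != f j)) -> equitable G f.
Proof.
move=> n_ge2 Gconn Gunw edgeE i j fij.
have pairE a : (a != f i) = (a == f j).
  move: (f i) (f j) fij a => [[|[|//]] ?] [[|[|//]] ?] //;
  by move=> _ [[|[|//]] ?].
have sum2 (F : 'I_2 -> R) : \sum_a F a = F (f i) + F (f j).
  by rewrite (bigD1 (f i)) //= (big_pred1 (f j)).
have V0 := lt0r_neq0 (volume_gt0 n_ge2 Gconn).
have degE := multipartite_degree Gunw edgeE.
rewrite (multipartite_weight Gunw edgeE) fij !degE.
move: V0; rewrite (multipartite_volume Gunw edgeE) -(sum_color_card R f) !sum2.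
set x := color_card R f _; set y := color_card R f _.
move=> V0; rewrite addrC addrK addrAC subrr add0r; move: V0.
rewrite [x + y - x]addrAC subrr add0r addrK [y * x]mulrC -mulr2n mulrn_eq0 /=.
by rewrite mulf_eq0 negb_or => /andP[x0 y0]; field; rewrite x0 y0.
Qed.

Lemma balanced_multipartite_card (R : realType) (n r : nat)
    (h : 'I_n -> 'I_r * 'I_(n %/ r)) (a : 'I_r) : bijective h ->
  color_card R (fun i => (h i).1) a = (n %/ r)%:R.
Proof.
move=> h_bij.
rewrite /color_card -(reindex (R := R) h (P := fun p => p.1 == a) (F := fun=> 1));
  last exact: onW_bij.
rewrite (eq_bigl (fun p => pred1 a p.1 && xpredT p.2)) => [|p]; last first.
  by rewrite /= andbT.
rewrite -(pair_big (pred1 a) xpredT (fun _ _ => 1)) big_pred1_eq.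
by rewrite sumr_const card_ord.
Qed.

(** * Kemeny's constant against the chromatic number *)

Theorem corollary4p2 (R : realType) (n : nat) (G : wgraph R n) (j : 'I_n) :
  (2 <= n)%N ->
  connected_graph G ->
  ((n%:R - 2 + 1 / (chromatic_number G)%:R)%:E <= kemeny G j)%E /\
  (unweighted G ->
    (kemeny G j = (n%:R - 2 + 1 / (chromatic_number G)%:R)%:E <->
      (chromatic_number G = 2%N /\ complete_bipartite (edge G)) \/
      (exists r : nat,
        [/\ chromatic_number G = r, (3 <= r)%N, (r %| n)%N &
            graph_iso (edge G) (@balanced_multipartite r n)]))).
Proof.
move=> n_ge2 Gconn.
have [f f_proper] : exists f : 'I_n -> 'I_(chromatic_number G),
    forall i j, edge G i j -> f i != f j.
  rewrite /chromatic_number; case: ex_minnP => r /existsP[f /forallP fP] _.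
  by exists f => a b; have /forallP/(_ b)/implyP := fP a.
have r_ge2 : (2 <= chromatic_number G)%N.
  have [l /f_proper] := exists_edge n_ge2 Gconn j.
  move: (f j) (f l); case: (chromatic_number G) => [[//]|[|//]] a b.
  by rewrite !ord1.
have bound r (g : 'I_n -> 'I_r) := @kemeny_coloring_bound R n G r g n_ge2 Gconn.
have [K [KE K_ge K_eq]] := bound _ f f_proper r_ge2.
split; first by rewrite KE lee_fin.
move=> Gunw; rewrite KE; split => [[/K_eq eqf]|].
  have edgeE := equitable_edge n_ge2 Gconn r_ge2 f_proper eqf.
  have surj := equitable_surj n_ge2 Gconn r_ge2 f_proper eqf.
  have [r_ge3|r_lt3] := leqP 3 (chromatic_number G); [right|left].
    exists (chromatic_number G).
    by have [] := equitable_iso n_ge2 Gconn Gunw r_ge2 f_proper eqf r_ge3.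
  have r2 : chromatic_number G = 2%N.
    by apply/eqP; rewrite eqn_leq r_ge2 andbT.
  split => //; move: f surj edgeE {f_proper K_eq eqf}; rewrite r2 => f surj edgeE.
  exists [set i | f i == 0]; split.
  - by have [i fi] := surj 0; apply/set0Pn; exists i; rewrite inE fi.
  - by have [i fi] := surj 1; apply/set0Pn; exists i; rewrite !inE fi.
  - move=> x y; rewrite edgeE !inE.
    by move: (f x) (f y) => [[|[|//]] ?] [[|[|//]] ?].
(* Conversely, the bound is applied to the colouring [g] given by the parts instead of [f]; both
   constants equal [kemeny G j]. *)
case=> [[r2 [A [_ _ AE]]]|[r [-> r_ge3 rn [h h_bij hE]]]].
  pose g i : 'I_2 := if i \in A then 0 else 1.
  have gE a b : edge G a b = (g a != g b).
    by rewrite AE /g; case: (a \in A); case: (b \in A).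
  have [K' [K'E _]] := bound _ g (fun a b => eqbLR (gE a b)) isT.
  have [->] : K%:E = K'%:E by rewrite -(KE j) K'E.
  by move=> [_ ->]; rewrite ?r2 //; apply: equitable_bipartite.
pose g i := (h i).1.
have gE a b : edge G a b = (g a != g b) by apply: hE.
have r_ge2' : (2 <= r)%N by apply: ltnW.
have [K' [K'E _]] := bound _ g (fun a b => eqbLR (gE a b)) r_ge2'.
have [->] : K%:E = K'%:E by rewrite -(KE j) K'E.
move=> [_ ->] //.
apply: (equitable_balanced n_ge2 Gunw gE r_ge2').
by move=> a; apply: balanced_multipartite_card.
Qed.
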